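(* Let $\rho=|\psi\rangle\langle\psi|$ be an $n$-qubit pure state, $S\subseteq[n]$ non-empty with $s=|S|$, $\epsilon>0$ and $1-\delta\in(0,1)$. Let $N_B=\lceil 8\log(1/\delta)\rceil$, $B=\lceil 4\cdot 3^s/\epsilon^2\rceil$, and perform $M=2N_BB$ independent local SIC-POVM measurements on the qubits of $S$ of copies of $\rho$, with outcomes $\mathbf{Q}_1,\dots,\mathbf{Q}_M\in\{1,2,3,4\}^s$ i.i.d. with distribution $P(\mathbf{q})=\operatorname{tr}\big(\rho\bigotimes_{i\in S}|\tilde\phi_{q_i}\rangle\langle\tilde\phi_{q_i}|\big)$. For each $1\le b\le N_B$ define $$\overline{\mathcal{C}}^{(b)}_{|\psi\rangle}(S)=1-3^s\frac1B\sum_{i=(b-1)B+1}^{bB}\mathbb{1}[\mathbf{Q}_{2i-1}=\mathbf{Q}_{2i}].$$ Then $$\Pr\Big[\big|\operatorname{median}\big(\overline{\mathcal{C}}^{(1)}_{|\psi\rangle}(S),\dots,\overline{\mathcal{C}}^{(N_B)}_{|\psi\rangle}(S)\big)-\mathcal{C}_{|\psi\rangle}(S)\big|\ge\epsilon\Big]\le\delta,$$ giving an upper bound $O\big(3^s\log(1/\delta)\epsilon^{-2}\big)$ on the number of SIC measurements needed to estimate $\mathcal{C}_{|\psi\rangle}(S)$.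
   Context: $[n]=\{1,\dots,n\}$ labels the qubits. For an $n$-qubit pure state $|\psi\rangle$ and a non-empty $S\subseteq[n]$ with $s=|S|$, the concentratable entanglement is $\mathcal{C}_{|\psi\rangle}(S)=1-\frac{1}{2^s}\sum_{\alpha\subseteq S}\operatorname{tr}(\rho_\alpha^2)$, where $\rho_\alpha$ is the reduced state of $|\psi\rangle\langle\psi|$ on the qubits in $\alpha$, and $\operatorname{tr}(\rho_\emptyset^2):=1$. A single-qubit SIC-POVM consists of $|\tilde\phi_j\rangle=\frac{1}{\sqrt2}|\phi_j\rangle$, $j=1,\dots,4$, where $|\phi_j\rangle$ are unit vectors in $\mathbb{C}^2$ with $|\langle\phi_j|\phi_k\rangle|^2=1/3$ for $j\neq k$, so that $\sum_j|\tilde\phi_j\rangle\langle\tilde\phi_j|=\mathbb{I}$. $\mathbb{1}[A]$ is $1$ if $A$ holds and $0$ otherwise. *)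

(* Defs.v *)
(* MathComp + MathComp-Analysis (R : realType), complex numbers R[i]
   from mathcomp-real-closed. *)
From HB Require Import structures.
From mathcomp Require Import all_boot all_order all_algebra.
From mathcomp Require Import reals exp.
From mathcomp Require Import complex.
Set Implicit Arguments. Unset Strict Implicit. Unset Printing Implicit Defensive.
Import Order.TTheory GRing.Theory Num.Theory.
Local Open Scope ring_scope.
Local Open Scope complex_scope.

Section Defs.
Variable R : realType.
Local Notation C := R[i].
Variable n : nat.

(* computational basis labels of n qubits *)
Definition bits := {ffun 'I_n -> bool}.

(* the qubits of a subset A of [n], as a finite type *)
Definition qsub (A : {set 'I_n}) := {i : 'I_n | i \in A}.

(* pure state vector psi (amplitudes in the computational basis) *)
Definition is_pure_state (psi : bits -> C) : Prop :=
  \sum_x (psi x)^* * psi x = 1.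

(* reduced state rho_alpha = tr_{[n]\alpha} |psi><psi|, matrix entry (a,b) *)
Definition reduced (psi : bits -> C) (alpha : {set 'I_n})
    (a b : {ffun qsub alpha -> bool}) : C :=
  \sum_(x : bits) \sum_(y : bits)
     (([forall j : qsub alpha, x (val j) == a j]
       && [forall j : qsub alpha, y (val j) == b j]
       && [forall i : 'I_n, (i \notin alpha) ==> (x i == y i)])%:R
      * (psi x * (psi y)^*)).

(* tr(rho_alpha^2), with tr(rho_emptyset^2) := 1 *)
Definition purity (psi : bits -> C) (alpha : {set 'I_n}) : R :=
  if alpha == set0 then 1 else
  complex.Re (\sum_(a : {ffun qsub alpha -> bool}) \sum_(b : {ffun qsub alpha -> bool})
        reduced psi a b * reduced psi b a).

(* concentratable entanglement C_{|psi>}(S) *)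
Definition conc_ent (psi : bits -> C) (S : {set 'I_n}) : R :=
  1 - (2 ^+ #|S|)^-1 * \sum_(alpha : {set 'I_n} | alpha \subset S) purity psi alpha.

(* single-qubit SIC-POVM: phi j (j < 4, 0-based) are unit vectors in C^2 *)
Definition inner (u v : bool -> C) : C := \sum_b (u b)^* * v b.

Definition is_SIC (phi : 'I_4 -> bool -> C) : Prop :=
  (forall j, inner (phi j) (phi j) = 1) /\
  (forall j k, j != k -> inner (phi j) (phi k) * (inner (phi j) (phi k))^* = 3%:R^-1) /\
  (* sum_j |phi~_j><phi~_j| = I *)
  (forall a b : bool, \sum_j (phi j a / (Num.sqrt (2:R))%:C)
                             * (phi j b / (Num.sqrt (2:R))%:C)^* = (a == b)%:R).

(* outcomes of local SIC measurement on the qubits of S: {1..4}^S, 0-based *)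
Definition outcome (S : {set 'I_n}) := {ffun qsub S -> 'I_4}.

(* P(q) = tr(rho (x)_{i in S} |phi~_{q_i}><phi~_{q_i}|)  (identity elsewhere)
        = sum_{x,y} conj(psi x) <x|O|y> psi y *)
Definition sic_prob (psi : bits -> C) (phi : 'I_4 -> bool -> C)
    (S : {set 'I_n}) (q : outcome S) : R :=
  let phit j b := phi j b / (Num.sqrt (2:R))%:C in
  complex.Re (\sum_(x : bits) \sum_(y : bits)
        (psi x)^* * psi y *
        ((\prod_(j : qsub S) (phit (q j) (x (val j)) * (phit (q j) (y (val j)))^*))
         * \prod_(i : 'I_n | i \notin S) (x i == y i)%:R)).
End Defs.

(* median of a finite list of reals: middle element of the sorted list for
   odd length, average of the two middle elements for even length *)
Definition median (R : realType) (s : seq R) : R :=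
  let t := sort <=%R s in
  let N := size t in
  if odd N then nth 0 t N./2
  else (nth 0 t N./2.-1 + nth 0 t N./2) / 2.

(* read the k-th (0-based) entry of a finite sequence of outcomes *)
Definition at_ (T : Type) (M : nat) (Q : {ffun 'I_M -> T}) (x0 : T) (k : nat) : T :=
  if insub k is Some i then Q i else x0.

(* batch estimator  C^(b) = 1 - 3^s (1/B) sum_{i=(b-1)B+1}^{bB} 1[Q_{2i-1} = Q_{2i}],
   with 1-based b, i and Q_1..Q_M (Q_k is entry k-1 of the ffun) *)
Definition batch_est (R : realType) (n : nat) (S : {set 'I_n}) (B M : nat)
    (Q : {ffun 'I_M -> outcome S}) (b : nat) : R :=
  let x0 := [ffun => ord0] : outcome S in
  1 - 3 ^+ #|S| * (B%:R)^-1 *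
      \sum_((b - 1) * B + 1 <= i < b * B + 1)
         (at_ Q x0 (2 * i - 1 - 1) == at_ Q x0 (2 * i - 1))%:R.

(* N_B = ceil(8 log(1/delta)), B = ceil(4 3^s / eps^2) *)
Definition NB (R : realType) (delta : R) : nat := `|Num.ceil (8 * ln (delta^-1))|%N.
Definition Bsz (R : realType) (s : nat) (eps : R) : nat :=
  `|Num.ceil (4 * 3 ^+ s / eps ^+ 2)|%N.

(* Main.v *)
(** The four states of a SIC-POVM form a 2-design: the operator
    [sum_j (|phi_j><phi_j|)^(x)2 - (2/3) (I + SWAP)] has Frobenius norm 0, by the
    equiangularity.  Hence the collision probability of two outcomes, a
    quadratic functional of [rho], satisfies
    [6^s sum_q P(q)^2 = sum_(A <= S) tr((rho (x) rho) SWAP_A)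
                      = sum_(A <= S) tr(rho_A^2)],
    so that each batch is an unbiased estimator of the concentratable
    entanglement, with variance at most [3^s / B] because purities are at most 1.
    By Chebyshev's inequality a batch is off by [eps] with probability at most
    1/4, and the median is off by [eps] only if at least half of the independent
    batches are, which has probability at most [exp(- N_B / 8)] by Chernoff's
    bound. *)
Require Import Defs.
From HB Require Import structures.
From mathcomp Require Import all_boot all_order all_algebra.
From mathcomp Require Import reals exp sequences.
From mathcomp Require Import complex.
From mathcomp Require Import ring lra zify.
Import Order.TTheory GRing.Theory Num.Theory.
Local Open Scope ring_scope.

(** * Finite products of probability spaces *)

Lemma ler_indic (R : numDomainType) (a b : bool) : (a -> b) -> a%:R <= b%:R :> R.
Proof. by move=> /implyP; case: a; case: b => //= _; rewrite ler01. Qed.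

(** Regroups i.i.d. samples into i.i.d. blocks along a bijection of index sets. It serves twice: to
    cut the samples into batches, and a batch into pairs. *)
Lemma iid_curry (R : comNzRingType) (A K J T : finType) (f : A * K -> J)
    (P : T -> R) (F : {ffun A -> {ffun K -> T}} -> R) : bijective f ->
  \sum_(Q : {ffun J -> T}) (\prod_j P (Q j))
     * F [ffun a => [ffun k => Q (f (a, k))]]
  = \sum_(q : {ffun A -> {ffun K -> T}}) (\prod_a \prod_k P (q a k)) * F q.
Proof.
case=> g fK gK.
rewrite (reindex (fun q : {ffun A -> {ffun K -> T}} =>
                    [ffun j => q (g j).1 (g j).2])) /=; last first.
  exists (fun Q : {ffun J -> T} => [ffun a => [ffun k => Q (f (a, k))]]) => q _.
    by apply/ffunP => a; apply/ffunP => k; rewrite !ffunE fK.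
  by apply/ffunP => j; rewrite !ffunE -surjective_pairing gK.
apply: eq_bigr => q _; congr (_ * F _).
  rewrite pair_big /= (reindex f); last by exists g => ? _.
  by apply: eq_bigr => -[a k] _; rewrite ffunE fK.
by apply/ffunP => a; apply/ffunP => k; rewrite !ffunE fK.
Qed.

Lemma iid_prod (R : comNzRingType) (A U : finType) (mu : U -> R)
    (G : A -> U -> R) :
  \sum_(q : {ffun A -> U}) (\prod_a mu (q a)) * \prod_a G a (q a)
  = \prod_a \sum_u mu u * G a u.
Proof.
by rewrite bigA_distr_bigA; apply: eq_bigr => q _; rewrite big_split.
Qed.

(** Independence factors the mean of [Y (q i) * Y (q j)]; for [i != j] the factor of the centred [Y]
    vanishes, so only the diagonal survives. *)
Lemma iid_variance (R : comNzRingType) (A U : finType) (mu Y : U -> R) :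
  \sum_u mu u = 1 -> \sum_u mu u * Y u = 0 ->
  \sum_(q : {ffun A -> U}) (\prod_a mu (q a)) * (\sum_a Y (q a)) ^+ 2
  = #|A|%:R * \sum_u mu u * Y u ^+ 2.
Proof.
move=> mu1 Y0.
under eq_bigr => q _ do rewrite expr2 big_distrlr /= mulr_sumr.
rewrite exchange_big /= mulr_natl -sumr_const.
apply: eq_bigr => i _.
under eq_bigr => q _ do rewrite mulr_sumr.
rewrite exchange_big /= (bigD1 i) //=.
(* The integrand becomes a product over all coordinates, with value 1 away from [i] and [j], so that
   [iid_prod] applies; for [i = j] both factors meet at one coordinate. *)
have E j : \sum_(q : {ffun A -> U}) (\prod_a mu (q a)) * (Y (q i) * Y (q j))
  = \prod_a \sum_u mu u * ((if a == i then Y u else 1) * (if a == j then Y u else 1)).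
  rewrite -iid_prod; apply: eq_bigr => q _; congr (_ * _).
  by rewrite big_split /= -!big_mkcond /= !big_pred1_eq.
rewrite [X in _ + X]big1 ?addr0; last first.
  move=> j nji; rewrite E (bigD1 i) //= eqxx (eq_sym i) (negbTE nji).
  by under eq_bigr => u _ do rewrite mulr1; rewrite Y0 mul0r.
rewrite E (bigD1 i) //= eqxx [X in _ * X]big1 ?mulr1 //.
by move=> a /negbTE ->; under eq_bigr => u _ do rewrite !mulr1.
Qed.

Lemma iid_chebyshev (R : realFieldType) (A U : finType) (mu Y : U -> R) (e : R) :
  (forall u, 0 <= mu u) -> \sum_u mu u = 1 -> \sum_u mu u * Y u = 0 -> 0 < e ->
  \sum_(q : {ffun A -> U}) (\prod_a mu (q a)) * (e <= `|\sum_a Y (q a)|)%R%:R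
  <= #|A|%:R * (\sum_u mu u * Y u ^+ 2) / e ^+ 2.
Proof.
move=> mu0 mu1 Y0 e0; rewrite ler_pdivlMr ?exprn_gt0 //.
rewrite -iid_variance // mulr_suml; apply: ler_sum => q _.
rewrite -mulrA ler_wpM2l ?prodr_ge0 //.
case: (leP e) => [le|_] /=; last by rewrite mul0r sqr_ge0.
by rewrite mulr1n mul1r -[X in _ <= X]real_normK ?num_real // lerXn2r // ?nnegrE ltW.
Qed.

Lemma iid_majority (R : realType) (U : finType) (N : nat) (mu : U -> R)
    (bad : pred U) :
  (forall u, 0 <= mu u) -> \sum_u mu u = 1 ->
  \sum_u mu u * (bad u)%:R <= 4^-1 ->
  \sum_(q : {ffun 'I_N -> U}) (\prod_a mu (q a))
     * (N <= 2 * #|[set a | bad (q a)]|)%N%:R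
  <= expR (- (N%:R / 8)).
Proof.
move=> mu0 mu1 badle.
(* With weight [s] on bad and [s^-1] on good outcomes, and bad probability 1/4, the mean weight s/4
   + 3/(4s) is least at s = sqrt 3. *)
pose s : R := Num.sqrt 3.
have s2 : s ^+ 2 = 3 by rewrite sqr_sqrtr.
have s0 : 0 < s by rewrite sqrtr_gt0.
have s1 : 1 <= s by rewrite -sqrtr1 ler_sqrt // ler1n.
pose w u := if bad u then s else s^-1.
have w0 u : 0 < w u by rewrite /w; case: ifP; rewrite ?invr_gt0.
(* Chernoff's bound at the exponential tilt 3 *)
apply: (@le_trans _ _ (\sum_(q : {ffun 'I_N -> U})
          (\prod_a mu (q a)) * \prod_a w (q a))).
  apply: ler_sum => q _; rewrite ler_wpM2l ?prodr_ge0 //.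
  case: (leqP N) => [le|_] /=; last by apply: prodr_ge0 => a _; exact: ltW.
  (* A bad majority makes this product at least 1: the exponent of [s] is at least that of [s^-1],
     and [s >= 1]. *)
  rewrite (bigID (fun a => bad (q a))) /=.
  rewrite (eq_bigr (fun=> s)); last by move=> a; rewrite /w => ->.
  rewrite [X in _ * X](eq_bigr (fun=> s^-1)); last first.
    by move=> a; rewrite /w => /negbTE ->.
  rewrite !prodr_const exprVn ler_pdivlMr ?exprn_gt0 // mul1r.
  apply: ler_weXn2l => //.
  have := cardC (fun a => bad (q a)); rewrite card_ord => NE.
  rewrite -(leq_add2l #|[pred a | bad (q a)]|).
  have -> : (#|[pred a | bad (q a)]| + #|[pred a | ~~ bad (q a)]| = N)%N.
    by rewrite -[RHS]NE.
  by move: le; rewrite cardsE mul2n -addnn.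
rewrite (iid_prod _ _ _ mu (fun=> w)) prodr_const card_ord.
rewrite -mulrN expRM_natl.
apply: lerXn2r; rewrite ?nnegrE ?expR_ge0 //.
  by apply: sumr_ge0 => u _; rewrite mulr_ge0 // ltW.
have -> : \sum_u mu u * w u = s^-1 + (s - s^-1) * \sum_u mu u * (bad u)%:R.
  rewrite mulr_sumr -[X in X + _]mul1r -{1}mu1 mulr_suml -big_split /=.
  by apply: eq_bigr => u _; rewrite /w; case: (bad u); rewrite /=; ring.
have sV : s^-1 = s / 3 by rewrite -s2; field; rewrite gt_eqF.
(* The mean weight increases with the bad probability, and at 1/4 it equals s/2. *)
apply: (@le_trans _ _ (s / 2)).
  rewrite sV.
  have : (s - s / 3) * \sum_u mu u * (bad u)%:R <= (s - s / 3) * 4^-1.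
    by rewrite ler_wpM2l //; lra.
  lra.
(* Squaring removes the root: 3/4 = 1 - 1/4 <= exp(-1/4). *)
rewrite -(@ler_pXn2r _ 2) ?nnegrE ?expR_ge0 ?divr_ge0 //; last exact: ltW.
rewrite -expRM_natl expr_div_n s2.
by apply: le_trans (expR_ge1Dx _); lra.
Qed.

(** In sorted order, a median too large forces every entry of the upper half to be too large, and a
    median too small every entry of the lower half to be too small. *)
Lemma median_majority (R : realType) (s : seq R) (c e : R) :
  e <= `|median s - c| -> (size s <= 2 * count (fun x => e <= `|x - c|)%R s)%N.
Proof.
rewrite /median; set t := sort _ s.
have tS : size t = size s by rewrite size_sort.
have <- : count (fun x => e <= `|x - c|)%R t = count (fun x => e <= `|x - c|)%R s.
  by rewrite count_sort.
rewrite -tS; set N := size t.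
case: (posnP N) => [->//|N0].
have le_nth i j : (i <= j < N)%N -> nth 0 t i <= nth 0 t j.
  case/andP=> ij jN; apply: sorted_leq_nth => //; rewrite ?inE //.
  - exact: le_trans.
  - exact: sort_le_sorted.
  - exact: leq_ltn_trans jN.
set m := (X in `|X - c|).
(* The indices [(N.-1)./2] and [N./2] of the two middle entries coincide for odd [N], so that [mL]
   and [mU] cover both parities. *)
have mU : m <= nth 0 t N./2.
  rewrite /m; case: ifP => // oN.
  have : nth 0 t N./2.-1 <= nth 0 t N./2 by apply: le_nth; lia.
  lra.
have mL : nth 0 t (N.-1)./2 <= m.
  rewrite /m; case: ifP => oN; first by apply: le_nth; lia.
  have -> : (N.-1)./2 = N./2.-1 by lia.
  have : nth 0 t N./2.-1 <= nth 0 t N./2 by apply: le_nth; lia.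
  lra.
have cnt (p : pred R) r : all p r -> count p r = size r by rewrite all_count => /eqP.
rewrite ler_normr => /orP[] h.
- rewrite -(cat_take_drop N./2 t) count_cat [X in (_ + X)%N]cnt ?size_drop -/N.
    by lia.
  apply/(all_nthP 0) => i; rewrite size_drop -/N => iN.
  rewrite nth_drop; have : nth 0 t N./2 <= nth 0 t (N./2 + i) by apply: le_nth; lia.
  by move=> ?; rewrite ler_normr; apply/orP; left; lra.
- rewrite -(cat_take_drop (N.-1)./2.+1 t) count_cat [X in (X + _)%N]cnt.
    by rewrite size_take -/N; case: (ltnP (N.-1)./2.+1); lia.
  apply/(all_nthP 0) => i; rewrite size_take -/N => iN.
  have {}iN : (i <= (N.-1)./2)%N by move: iN; case: (ltnP (N.-1)./2.+1); lia.
  rewrite nth_take //.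
  have : nth 0 t i <= nth 0 t (N.-1)./2 by apply: le_nth; lia.
  by move=> ?; rewrite ler_normr; apply/orP; right; lra.
Qed.

(** * Local 2-designs and swap expectations *)

(** In matrix entries, [(a == b)%:R * (c == d)%:R] is the identity on two qubits and
    [(a == d)%:R * (c == b)%:R] the swap. *)
Lemma equiangular_2design (C : numClosedFieldType) (phi : 'I_4 -> bool -> C)
    (a b c d : bool) :
  (forall j, \sum_b (phi j b)^* * phi j b = 1) ->
  (forall j k, j != k ->
     (\sum_b (phi j b)^* * phi k b) * (\sum_b (phi j b)^* * phi k b)^* = 3^-1) ->
  \sum_j phi j a * (phi j b)^* * (phi j c * (phi j d)^*)
  = 2 / 3 * ((a == b)%:R * (c == d)%:R + (a == d)%:R * (c == b)%:R).
Proof.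
pose inner (u v : bool -> C) := \sum_b (u b)^* * v b.
move=> unit_phi overlap.
have {}unit_phi j : inner (phi j) (phi j) = 1 by exact: unit_phi.
have {}overlap j k : j != k -> inner (phi j) (phi k) * (inner (phi j) (phi k))^* = 3^-1.
  exact: overlap.
pose t j a b c d := phi j a * (phi j b)^* * (phi j c * (phi j d)^*).
pose E (a b c d : bool) : C := (a == b)%:R * (c == d)%:R + (a == d)%:R * (c == b)%:R.
pose D a b c d := \sum_j t j a b c d - 2 / 3 * E a b c d.
(* The squared Frobenius norm of D is Sum_jk |<phi_j|phi_k>|^4 - 32/3 + 16/3 = 0. *)
suff D0 : \sum_a \sum_b \sum_c \sum_d D a b c d * (D a b c d)^* = 0.
  (* A vanishing sum of nonnegative terms has only zero terms; this is applied to one index at a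
     time. *)
  have ge0 a' b' c' d' : 0 <= D a' b' c' d' * (D a' b' c' d')^*.
    exact: mul_conjC_ge0.
  apply/eqP; rewrite -subr_eq0 -/(E a b c d) -/(t _ _ _ _ _) -mul_conjC_eq0.
  rewrite -/(D a b c d).
  have D1 := psumr_eq0P (fun i _ => sumr_ge0 _ (fun j _ => sumr_ge0 _ (fun k _ =>
    sumr_ge0 _ (fun l _ => ge0 i j k l)))) D0 (i := a) isT.
  have D2 := psumr_eq0P (fun j _ => sumr_ge0 _ (fun k _ =>
    sumr_ge0 _ (fun l _ => ge0 a j k l))) D1 (i := b) isT.
  have D3 := psumr_eq0P (fun k _ =>
    sumr_ge0 _ (fun l _ => ge0 a b k l)) D2 (i := c) isT.
  by rewrite (psumr_eq0P (fun l _ => ge0 a b c l) D3 (i := d) isT).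
pose s4 (F : bool -> bool -> bool -> bool -> C) :=
  \sum_a \sum_b \sum_c \sum_d F a b c d.
have s4lin x y F1 F2 F3 F4 :
    s4 (fun a b c d => F1 a b c d + (x * (F2 a b c d + F3 a b c d) + y * F4 a b c d))
    = s4 F1 + (x * (s4 F2 + s4 F3) + y * s4 F4).
  by rewrite /s4 !big_bool /=; ring.
have s4sum (F : 'I_4 -> bool -> bool -> bool -> bool -> C) :
    s4 (fun a b c d => \sum_j F j a b c d) = \sum_j s4 (F j).
  rewrite /s4 [RHS]exchange_big; apply: eq_bigr => ? _.
  rewrite [RHS]exchange_big; apply: eq_bigr => ? _.
  rewrite [RHS]exchange_big; apply: eq_bigr => ? _.
  by rewrite [RHS]exchange_big.
have s4E F G : (forall a b c d, F a b c d = G a b c d) -> s4 F = s4 G.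
  move=> FG; do 4 (apply: eq_bigr => ? _); exact: FG.
have EC x y z w : (E x y z w)^* = E x y z w.
  by rewrite /E rmorphD /= !rmorphM /= !rmorph_nat.
(* Each projector is Hermitian, so conjugation transposes both tensor factors; [tt] is then the
   Hilbert-Schmidt product of two projectors on two copies. *)
have tC j x y z w : (t j x y z w)^* = t j y x w z.
  rewrite /t !rmorphM /= !conjCK; ring.
have tt j k : s4 (fun a b c d => t j a b c d * t k b a d c)
              = (inner (phi j) (phi k) * (inner (phi j) (phi k))^*) ^+ 2.
  rewrite /s4 /inner /t rmorph_sum /= !big_bool /= !rmorphM /= !conjCK; ring.
(* The vector phi (x) phi is fixed by the swap, whence the factor 2. *)
have tE j : s4 (fun a b c d => E a b c d * t j a b c d)
    = 2 * inner (phi j) (phi j) ^+ 2.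
  rewrite /s4 /inner /t /E !big_bool /=; ring.
have tE' j : s4 (fun a b c d => E a b c d * t j b a d c)
    = 2 * inner (phi j) (phi j) ^+ 2.
  rewrite /s4 /inner /t /E !big_bool /=; ring.
(* This is tr((I + SWAP)^2) = 2 tr(I + SWAP) = 2 (4 + 2). *)
have EE : s4 (fun a b c d => E a b c d * E a b c d) = 12.
  rewrite /s4 /E !big_bool /=; ring.
pose X1 a b c d := \sum_j \sum_k t j a b c d * t k b a d c.
pose X2 a b c d := \sum_j E a b c d * t j a b c d.
pose X3 a b c d := \sum_j E a b c d * t j b a d c.
pose X4 a b c d := E a b c d * E a b c d.
transitivity (s4 X1 + (- (2 / 3) * (s4 X2 + s4 X3) + 4 / 9 * s4 X4)).
  rewrite -s4lin; apply: s4E => x y z w.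
  rewrite /X1 /X2 /X3 /X4 /D rmorphB rmorphM /= EC rmorph_sum /=.
  rewrite fmorph_div /= !rmorph_nat -big_distrlr -!mulr_sumr /=.
  have -> : \sum_j (t j x y z w)^* = \sum_j t j y x w z.
    by apply: eq_bigr => j _; exact: tC.
  by field.
rewrite /X1 /X2 /X3 /X4 EE !s4sum.
under eq_bigr => j _ do rewrite s4sum.
under eq_bigr => j _ do under eq_bigr => k _ do rewrite tt.
under [X in _ + (_ * (X + _) + _)]eq_bigr => j _ do rewrite tE unit_phi.
under [X in _ + (_ * (_ + X) + _)]eq_bigr => j _ do rewrite tE' unit_phi.
(* Each row has one squared overlap 1 and three equal to 1/3. *)
have -> : \sum_(j < 4) \sum_(k < 4)
    (inner (phi j) (phi k) * (inner (phi j) (phi k))^*) ^+ 2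
  = \sum_(j < 4) (1 + 3 * (3^-1) ^+ 2).
  apply: eq_bigr => j _; rewrite (bigD1 j) //= unit_phi rmorph1 mul1r expr1n.
  congr (_ + _); rewrite (eq_bigr (fun=> (3^-1) ^+ 2)).
    by rewrite sumr_const cardC1 card_ord mulr_natl.
  by move=> k nk; rewrite overlap // eq_sym.
by rewrite !sumr_const card_ord; field.
Qed.

Lemma prodr_indic (R : comNzRingType) (I : finType) (P b : pred I) :
  \prod_(i | P i) (b i)%:R = [forall i, P i ==> b i]%:R :> R.
Proof.
case: (boolP [forall _, _]) => [/forallP h|].
  by rewrite big1 // => i Pi; have := h i; rewrite Pi /= => ->.
rewrite negb_forall; case/existsP => i; rewrite negb_imply => /andP[Pi /negbTE bi].
by rewrite (bigD1 i) //= bi mul0r.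
Qed.

Lemma sum_indic (R : comNzRingType) (I : finType) (i : I) (F : I -> R) :
  \sum_j (j == i)%:R * F j = F i.
Proof.
rewrite (bigD1 i) //= eqxx mul1r big1 ?addr0 // => j /negbTE ->.
by rewrite mul0r.
Qed.

(* [M k a b] is the matrix entry [<a|M_k|b>] of the [k]-th effect of a qubit. *)
Definition born (C : numClosedFieldType) (n : nat) (psi : bits n -> C)
    (K : finType) (M : K -> bool -> bool -> C) (S : {set 'I_n})
    (q : {ffun qsub S -> K}) : C :=
  \sum_x \sum_y (psi x)^* * psi y *
    ((\prod_(j : qsub S) M (q j) (x (val j)) (y (val j)))
     * \prod_(i | i \notin S) (x i == y i)%:R).
Arguments born {C n} psi {K} M S q.

Lemma prod_qsub (R : comNzRingType) (n : nat) (S : {set 'I_n}) (F : 'I_n -> R) :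
  \prod_(j : qsub S) F (val j) = \prod_(i in S) F i.
Proof.
rewrite (reindex_omap (val : qsub S -> 'I_n) insub) => [|i iS]; last first.
  by rewrite insubT.
by apply: eq_bigl => j; rewrite valK eqxx (valP j).
Qed.

(** Contracting the qubits of [S] with the product vector leaves, up to conjugation, a vector [A] on
    the remaining qubits, and the Born weight is its squared norm. *)
Lemma born_ge0 (C : numClosedFieldType) (n : nat) (psi : bits n -> C)
    (K : finType) (v : K -> bool -> C) (S : {set 'I_n}) (q : {ffun qsub S -> K}) :
  0 <= born psi (fun k a b => v k a * (v k b)^*) S q.
Proof.
(* Labels of the qubits outside [S] are encoded as full bit strings that vanish on [S]. *)
pose out (x : bits n) : bits n := [ffun i => (i \notin S) && x i].
pose A (z : bits n) := \sum_x (out x == z)%:R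
    * ((psi x)^* * \prod_(j : qsub S) v (q j) (x (val j))).
suff -> : born psi (fun k a b => v k a * (v k b)^*) S q = \sum_z A z * (A z)^*.
  by apply: sumr_ge0 => z _; exact: mul_conjC_ge0.
rewrite /A; under [RHS]eq_bigr => z _ do rewrite rmorph_sum big_distrlr /=.
rewrite exchange_big; apply: eq_bigr => x _.
rewrite exchange_big; apply: eq_bigr => y _ /=.
rewrite prodr_indic.
have -> : [forall i, (i \notin S) ==> (x i == y i)] = (out y == out x).
  apply/forallP/eqP => [h|h i].
    apply/ffunP => i; rewrite !ffunE; have := h i.
    by case: (i \notin S) => //= /eqP ->.
  apply/implyP => iS; move/ffunP: h => /(_ i); rewrite !ffunE iS /= => ->.
  by [].
under eq_bigr => z _ do rewrite (eq_sym (out x)) -mulrA.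
rewrite sum_indic !rmorphM /= rmorph_prod rmorph_nat conjCK big_split /=.
ring.
Qed.

(** The sum over [q] factors over the qubits of [S], where completeness gives the identity; with the
    identity outside [S] this leaves only [x = y]. *)
Lemma sum_born (C : numClosedFieldType) (n : nat) (psi : bits n -> C)
    (K : finType) (M : K -> bool -> bool -> C) (S : {set 'I_n}) :
  (forall a b, \sum_k M k a b = (a == b)%:R) ->
  \sum_q born psi M S q = \sum_x (psi x)^* * psi x.
Proof.
move=> sumM; rewrite exchange_big; apply: eq_bigr => x _.
rewrite exchange_big /= -[RHS](sum_indic _ _ x (fun y => (psi x)^* * psi y)).
apply: eq_bigr => y _; rewrite -mulr_sumr -mulr_suml mulrC; congr (_ * _).
rewrite -(bigA_distr_bigA (fun (j : qsub S) k => M k (x (val j)) (y (val j)))) /=.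
rewrite (eq_bigr (fun j : qsub S => (x (val j) == y (val j))%:R)); last first.
  by move=> j _; exact: sumM.
rewrite (prod_qsub _ _ S (fun i => (x i == y i)%:R)).
transitivity (\prod_i (x i == y i)%:R : C).
  by rewrite [RHS](bigID (mem S)).
rewrite prodr_indic; congr ((nat_of_bool _)%:R).
apply/forallP/eqP => [h|-> i]; last by rewrite eqxx.
by apply/ffunP => i; apply/esym/eqP; exact: h.
Qed.

Definition swap (n : nat) (A : {set 'I_n}) (z : bits n * bits n) : bits n * bits n :=
  ([ffun i => if i \in A then z.2 i else z.1 i],
   [ffun i => if i \in A then z.1 i else z.2 i]).
Arguments swap {n} A z.

Lemma swapK (n : nat) (A : {set 'I_n}) : involutive (swap A).
Proof.
case=> x y; rewrite /swap /=.
by congr (_, _); apply/ffunP => i; rewrite !ffunE /=; case: (i \in A).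
Qed.

(** This is tr((rho (x) rho) SWAP_A) for rho = |psi><psi|, in the computational basis. *)
Definition swap_expect (C : numClosedFieldType) (n : nat) (psi : bits n -> C)
    (A : {set 'I_n}) : C :=
  \sum_z (psi z.1 * psi z.2)^* * (psi (swap A z).1 * psi (swap A z).2).
Arguments swap_expect {C n} psi A.

(** Each of [p] and [p'] holds the row and column label of one copy; the indicator, the matrix of
    [f] on the product basis, determines both columns from both rows. *)
Lemma sum_indic2 (R : comNzRingType) (T : finType) (f : T * T -> T * T)
    (F : T * T -> T * T -> R) :
  \sum_p \sum_p' ((p.2, p'.2) == f (p.1, p'.1))%:R * F p p'
  = \sum_z F (z.1, (f z).1) (z.2, (f z).2).
Proof.
transitivity (\sum_z \sum_w (w == f z)%:R * F (z.1, w.1) (z.2, w.2)); last first.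
  apply: eq_bigr => z _.
  exact: (sum_indic _ _ (f z) (fun w => F (z.1, w.1) (z.2, w.2))).
rewrite !pair_big /=.
(* Exchanges grouping by row and column with grouping by copy. *)
pose tr (u : (T * T) * (T * T)) := ((u.1.1, u.2.1), (u.1.2, u.2.2)).
have trK : involutive tr by move=> [[? ?] [? ?]].
rewrite (reindex_inj (inv_inj trK)) /=.
by apply: eq_bigr => -[[? ?] [? ?]] _.
Qed.

(** On each qubit of [S] the effects on two copies sum to (I + SWAP)/6; expanding the product over
    [S] selects the set [A] of swapped qubits. *)
Lemma born_collision (C : numClosedFieldType) (n : nat) (psi : bits n -> C)
    (K : finType) (M : K -> bool -> bool -> C) (S : {set 'I_n}) :
  (forall a b c d, \sum_k M k a b * M k c d
     = 6^-1 * ((a == b)%:R * (c == d)%:R + (a == d)%:R * (c == b)%:R)) ->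
  6 ^+ #|S| * \sum_q born psi M S q ^+ 2
  = \sum_(A : {set 'I_n} | A \subset S) swap_expect psi A.
Proof.
move=> M2.
pose id1 (x y x' y' : bits n) i : C := (x i == y i)%:R * (x' i == y' i)%:R.
pose sw1 (x y x' y' : bits n) i : C := (x i == y' i)%:R * (x' i == y i)%:R.
have E (x y x' y' : bits n) :
    6 ^+ #|S| * \sum_(q : {ffun qsub S -> K})
      ((\prod_(j : qsub S) M (q j) (x (val j)) (y (val j)))
        * \prod_(i | i \notin S) (x i == y i)%:R)
      * ((\prod_(j : qsub S) M (q j) (x' (val j)) (y' (val j)))
        * \prod_(i | i \notin S) (x' i == y' i)%:R)
  = \sum_(A : {set 'I_n} | A \subset S) ((y, y') == swap A (x, x'))%:R.
  rewrite (eq_bigr (fun q : {ffun qsub S -> K} =>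
     (\prod_(j : qsub S) (M (q j) (x (val j)) (y (val j))
                          * M (q j) (x' (val j)) (y' (val j))))
     * \prod_(i | i \notin S) id1 x y x' y' i)); last first.
    by move=> q _; rewrite big_split mulrACA; congr (_ * _); rewrite -big_split.
  rewrite -mulr_suml mulrA.
  rewrite -(bigA_distr_bigA (fun (j : qsub S) k =>
     M k (x (val j)) (y (val j)) * M k (x' (val j)) (y' (val j)))) /=.
  rewrite (eq_bigr (fun j : qsub S =>
     6^-1 * (id1 x y x' y' (val j) + sw1 x y x' y' (val j)))); last first.
    by move=> j _; exact: M2.
  rewrite (prod_qsub _ _ S (fun i => 6^-1 * (id1 x y x' y' i + sw1 x y x' y' i))).
  rewrite big_split /= prodr_const mulrA -exprMn divff ?pnatr_eq0 // expr1n mul1r.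
  (* The coefficient [(i \in S)%:R] extends the product to all qubits, so that it expands over all
     sets [A]; those not inside [S] contribute 0. *)
  transitivity (\prod_i ((i \in S)%:R * sw1 x y x' y' i + id1 x y x' y' i)).
    rewrite [RHS](bigID (mem S)) /=; congr (_ * _); apply: eq_bigr => i.
      by move=> ->; rewrite mul1r addrC.
    by move=> /negbTE ->; rewrite mul0r add0r.
  rewrite bigA_distr /= [RHS]big_mkcond /=; apply: eq_bigr => A _.
  have eqA i : (if i \in A then sw1 x y x' y' i else id1 x y x' y' i)
    = ((y i == (swap A (x, x')).1 i) && (y' i == (swap A (x, x')).2 i))%:R.
    rewrite /sw1 /id1 /= !ffunE /=.
    case: ifP => _; rewrite -natrM mulnb [y i == _]eq_sym [y' i == _]eq_sym //.
    by rewrite andbC.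
  case: ifP => AS.
    transitivity (\prod_i ((y i == (swap A (x, x')).1 i)
                           && (y' i == (swap A (x, x')).2 i))%:R : C).
      apply: eq_bigr => i _; rewrite -eqA; case: ifP => // iA.
      by rewrite (subsetP AS) // mul1r.
    rewrite prodr_indic; congr ((nat_of_bool _)%:R); case: (swap A _) => u v /=.
    rewrite xpair_eqE; apply/forallP/andP => [h|[/eqP-> /eqP->] i]; last first.
      by rewrite !eqxx.
    by split; apply/eqP/ffunP => i; have /andP[/eqP ? /eqP ?] := h i.
  move/negbT/subsetPn: AS => [i iA /negbTE iS].
  by rewrite (bigD1 i) //= iA iS !mul0r.
pose Psi (p p' : bits n * bits n) :=
  (psi p.1)^* * psi p.2 * ((psi p'.1)^* * psi p'.2).
transitivity (\sum_(A : {set 'I_n} | A \subset S) \sum_p \sum_p'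
   ((p.2, p'.2) == swap A (p.1, p'.1))%:R * Psi p p'); last first.
  apply: eq_bigr => A _; rewrite (sum_indic2 _ _ (swap A) Psi).
  by apply: eq_bigr => z _; rewrite /Psi rmorphM mulrACA.
rewrite /born; under eq_bigr => q _ do rewrite pair_big expr2 big_distrlr /=.
rewrite exchange_big mulr_sumr [RHS]exchange_big; apply: eq_bigr => -[x y] _ /=.
rewrite exchange_big mulr_sumr [RHS]exchange_big; apply: eq_bigr => -[x' y'] _ /=.
rewrite -mulr_suml -E -mulrA mulr_suml; congr (_ * _); apply: eq_bigr => q _.
by rewrite mulrACA mulrC.
Qed.

(** The swap trick. For [p = (x, y)] and [p' = (x', y')], the matrix product makes [y] agree with
    [x'] and [y'] with [x] on [A], while the partial traces identify [x] with [y] and [x'] with [y']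
    off [A]. *)
Lemma sum_reduced (C : numClosedFieldType) (n : nat) (psi : bits n -> C)
    (A : {set 'I_n}) :
  let rho (a b : {ffun qsub A -> bool}) := \sum_(x : bits n) \sum_(y : bits n)
    ([forall j : qsub A, x (val j) == a j] && [forall j : qsub A, y (val j) == b j]
     && [forall i : 'I_n, (i \notin A) ==> (x i == y i)])%:R * (psi x * (psi y)^*) in
  \sum_a \sum_b rho a b * rho b a = swap_expect psi A.
Proof.
move=> rho.
pose res (x : bits n) := [ffun j : qsub A => x (val j)].
pose same (x y : bits n) := [forall i : 'I_n, (i \notin A) ==> (x i == y i)].
pose W (p : bits n * bits n) := (same p.1 p.2)%:R * (psi p.1 * (psi p.2)^*).
have resE (x : bits n) (a : {ffun qsub A -> bool}) :
    [forall j : qsub A, x (val j) == a j] = (a == res x).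
  apply/forallP/eqP => [h|-> j]; last by rewrite ffunE.
  by apply/ffunP => j; rewrite ffunE; apply/esym/eqP.
have rhoE a b : rho a b
    = \sum_p (a == res p.1)%:R * ((b == res p.2)%:R * W p).
  rewrite /rho pair_big; apply: eq_bigr => -[x y] _ /=.
  by rewrite !resE /W /= !mulrA -!natrM !mulnb.
pose F (p p' : bits n * bits n) :=
  psi p.1 * (psi p.2)^* * (psi p'.1 * (psi p'.2)^*).
transitivity (\sum_p \sum_p' ((p.2, p'.2) == swap A (p.1, p'.1))%:R * F p p');
  last first.
  (* Reindexing by the swap moves the conjugation to the swapped labels, as it stands in the summand
     of [F]. *)
  rewrite sum_indic2 /swap_expect [RHS](reindex_inj (inv_inj (swapK _ A))).
  by apply: eq_bigr => z _; rewrite swapK rmorphM /F mulrACA mulrC.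
have E p p' : \sum_a \sum_b (a == res p.1)%:R * ((b == res p.2)%:R * W p)
    * ((b == res p'.1)%:R * ((a == res p'.2)%:R * W p'))
    = ((p.2, p'.2) == swap A (p.1, p'.1))%:R * F p p'.
  transitivity (\sum_a (a == res p.1)%:R * \sum_b (b == res p.2)%:R
     * ((b == res p'.1)%:R * (a == res p'.2)%:R * (W p * W p'))).
    apply: eq_bigr => a _; rewrite mulr_sumr; apply: eq_bigr => b _; ring.
  rewrite (sum_indic _ _ (res p.1)) (sum_indic _ _ (res p.2)).
  rewrite /W [X in _ * X = _]mulrACA [LHS]mulrA -!natrM !mulnb.
  congr ((nat_of_bool _)%:R * _).
  case: p p' => [x y] [x' y'] /=; rewrite xpair_eqE.
  apply/idP/andP => [/andP[/andP[/eqP r1 /eqP r2] /andP[/forallP s1 /forallP s2]]|].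
    split; apply/eqP/ffunP => i; rewrite ffunE /=; case: ifP => iA.
    - by move/ffunP: r1 => /(_ (Sub i iA)); rewrite !ffunE.
    - by have := s1 i; rewrite iA /= => /eqP.
    - by move/ffunP: r2 => /(_ (Sub i iA)); rewrite !ffunE.
    - by have := s2 i; rewrite iA /= => /eqP.
  move=> [/eqP -> /eqP ->].
  apply/andP; split; apply/andP; split.
  - by apply/eqP/ffunP => j; rewrite !ffunE (valP j).
  - by apply/eqP/ffunP => j; rewrite !ffunE (valP j).
  - by apply/forallP => i; apply/implyP => /negbTE iA; rewrite ffunE iA.
  - by apply/forallP => i; apply/implyP => /negbTE iA; rewrite ffunE iA.
under [RHS]eq_bigr => p _ do under eq_bigr => p' _ do rewrite -E.
rewrite [RHS](eq_bigr (fun p => \sum_a \sum_p' \sum_b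
   (a == res p.1)%:R * ((b == res p.2)%:R * W p)
    * ((b == res p'.1)%:R * ((a == res p'.2)%:R * W p')))); last first.
  by move=> p _; rewrite exchange_big.
rewrite [RHS]exchange_big; apply: eq_bigr => a _ /=.
under [RHS]eq_bigr => p _ do rewrite exchange_big /=.
rewrite [RHS]exchange_big; apply: eq_bigr => b _ /=.
by rewrite !rhoE big_distrlr.
Qed.

Lemma sum_norm_sqr2 (C : numClosedFieldType) (n : nat) (psi : bits n -> C) :
  \sum_z (psi z.1 * psi z.2)^* * (psi z.1 * psi z.2)
  = (\sum_x (psi x)^* * psi x) ^+ 2.
Proof.
rewrite expr2 big_distrlr pair_big; apply: eq_bigr => z _ /=.
by rewrite rmorphM mulrACA.
Qed.

Local Open Scope complex_scope.

(** * SIC outcome probabilities *)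

Definition sic_vec (R : realType) (phi : 'I_4 -> bool -> R[i]) (j : 'I_4)
    (b : bool) : R[i] :=
  phi j b / (Num.sqrt (2 : R))%:C.

Definition sic_effect (R : realType) (phi : 'I_4 -> bool -> R[i]) (j : 'I_4)
    (a b : bool) : R[i] :=
  sic_vec R phi j a * (sic_vec R phi j b)^*.

Lemma sic_effectE (R : realType) (phi : 'I_4 -> bool -> R[i]) j a b :
  sic_effect R phi j a b = phi j a * (phi j b)^* / 2.
Proof.
have conj_div (C : numClosedFieldType) (x y r : C) :
    x / r * (y / r)^* = x * y^* / (r * r^*).
  by rewrite rmorphM fmorphV invfM mulrACA.
rewrite /sic_effect /sic_vec conj_div; congr (_ / _).
transitivity ((Num.sqrt 2 : R)%:C * (Num.sqrt 2 : R)%:C).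
  by congr (_ * _); exact: conjc_real.
by rewrite -rmorphM /= -expr2 sqr_sqrtr // rmorph_nat.
Qed.

Lemma sum_sic_effect (R : realType) (phi : 'I_4 -> bool -> R[i]) a b :
  is_SIC phi ->
  \sum_j sic_effect R phi j a b = (a == b)%:R.
Proof. by case=> _ [_]; exact. Qed.

Lemma sum_sic_effect2 (R : realType) (phi : 'I_4 -> bool -> R[i]) a b c d :
  is_SIC phi ->
  \sum_j sic_effect R phi j a b * sic_effect R phi j c d
  = 6^-1 * ((a == b)%:R * (c == d)%:R + (a == d)%:R * (c == b)%:R).
Proof.
move=> sic; have := equiangular_2design _ phi a b c d sic.1 sic.2.1.
set E := (X in _ * X) => H.
(* Each of the two effects carries a factor 1/2, which turns the constant 2/3 of the projectors into
   1/6. *)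
have -> : 6^-1 * E = (2 / 3 * E) / 4 by field.
rewrite -H mulr_suml; apply: eq_bigr => j _; rewrite !sic_effectE; by field.
Qed.

Lemma Re_sum (R : realType) (I : finType) (P : pred I) (F : I -> R[i]) :
  complex.Re (\sum_(i | P i) F i) = \sum_(i | P i) complex.Re (F i).
Proof. by apply: (big_morph (@complex.Re R)) => // -[? ?] [? ?]. Qed.

(** The value 1 set for the empty set agrees with the swap formula: swapping nothing gives the
    fourth power of the norm of [psi]. *)
Lemma purityE (R : realType) (n : nat) (psi : bits n -> R[i]) (A : {set 'I_n}) :
  is_pure_state psi -> purity psi A = complex.Re (swap_expect psi A).
Proof.
move=> psi1; rewrite /purity; case: eqVneq => [->|_]; last first.
  by congr complex.Re; exact: sum_reduced.
transitivity (complex.Re ((\sum_x (psi x)^* * psi x) ^+ 2)).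
  by rewrite psi1 expr1n.
rewrite -sum_norm_sqr2; congr complex.Re; apply: eq_bigr => z _; congr (_ * _).
by congr (psi _ * psi _); apply/ffunP => i; rewrite ffunE inE.
Qed.

Lemma purity_le1 (R : realType) (n : nat) (psi : bits n -> R[i]) (A : {set 'I_n}) :
  is_pure_state psi -> purity psi A <= 1.
Proof.
move=> psi1; rewrite purityE //.
pose Psi (z : bits n * bits n) := psi z.1 * psi z.2.
have Psi1 : \sum_z complex.Re ((Psi z)^* * Psi z) = 1.
  by rewrite -Re_sum sum_norm_sqr2 psi1 expr1n.
have Psi2 : \sum_z complex.Re ((Psi (swap A z))^* * Psi (swap A z)) = 1.
  by rewrite -Psi1 [RHS](reindex_inj (inv_inj (swapK _ A))).
(* AM-GM, the swap being a permutation of the product basis *)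
have amgm (u v : R[i]) : complex.Re (u^* * v)%R
    <= (complex.Re (u^* * u)%R + complex.Re (v^* * v)%R) / 2.
  rewrite -[(u^*)%R]/(conjc u) -[(v^*)%R]/(conjc v).
  case: u v => [a b] [c d] /=.
  have := sqr_ge0 (a - c); have := sqr_ge0 (b - d); nra.
rewrite /swap_expect Re_sum.
apply: le_trans (ler_sum _ (fun z _ => amgm (Psi z) (Psi (swap A z)))) _.
rewrite -mulr_suml big_split /= Psi1.
by rewrite Psi2; lra.
Qed.

(** A nonnegative Born weight is real, so the real part taken in [sic_prob] loses nothing. *)
Lemma sic_probE (R : realType) (n : nat) (psi : bits n -> R[i])
    (phi : 'I_4 -> bool -> R[i]) (S : {set 'I_n}) (q : outcome S) :
  (sic_prob psi phi q)%:C = born psi (sic_effect R phi) S q.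
Proof.
by rewrite RRe_real //; apply/ger0_real/(born_ge0 _ _ psi _ (sic_vec R phi)).
Qed.

Lemma sic_prob_ge0 (R : realType) (n : nat) (psi : bits n -> R[i])
    (phi : 'I_4 -> bool -> R[i]) (S : {set 'I_n}) (q : outcome S) :
  0 <= sic_prob psi phi q.
Proof. by rewrite -ler0c sic_probE; exact: (born_ge0 _ _ psi _ (sic_vec R phi)). Qed.

Lemma sum_sic_prob (R : realType) (n : nat) (psi : bits n -> R[i])
    (phi : 'I_4 -> bool -> R[i]) (S : {set 'I_n}) :
  is_pure_state psi -> is_SIC phi -> \sum_(q : outcome S) sic_prob psi phi q = 1.
Proof.
move=> psi1 sic; apply: (@complexI R); rewrite rmorph_sum /=.
under eq_bigr => q _ do rewrite sic_probE.
by rewrite sum_born ?psi1 // => a b; exact: sum_sic_effect.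
Qed.

(** Splitting 6^s into 2^s 3^s brings the collision identity to the normalisation of [conc_ent]. *)
Lemma sic_collision (R : realType) (n : nat) (psi : bits n -> R[i])
    (phi : 'I_4 -> bool -> R[i]) (S : {set 'I_n}) :
  is_pure_state psi -> is_SIC phi ->
  3 ^+ #|S| * \sum_(q : outcome S) sic_prob psi phi q ^+ 2
  = (2 ^+ #|S|)^-1 * \sum_(A : {set 'I_n} | A \subset S) purity psi A.
Proof.
move=> psi1 sic.
have H := born_collision _ _ psi _ (sic_effect R phi) S
  (fun a b c d => sum_sic_effect2 R phi a b c d sic).
have {}H : 6 ^+ #|S| * \sum_(q : outcome S) sic_prob psi phi q ^+ 2
  = \sum_(A : {set 'I_n} | A \subset S) purity psi A.
  under [RHS]eq_bigr => A _ do rewrite purityE //.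
  rewrite -Re_sum -H.
  have -> : \sum_q born psi (sic_effect R phi) S q ^+ 2
    = (\sum_(q : outcome S) sic_prob psi phi q ^+ 2)%:C.
    by rewrite rmorph_sum; apply: eq_bigr => q _; rewrite -sic_probE rmorphXn.
  have -> : 6 ^+ #|S| = (6 ^+ #|S|)%:C :> R[i] by rewrite rmorphXn rmorph_nat.
  by rewrite -rmorphM.
have n0 : 2 ^+ #|S| != 0 :> R by rewrite expf_neq0 // pnatr_eq0.
apply: (mulfI n0); rewrite mulrA -exprMn mulVKf // -H; congr (_ ^+ _ * _).
by rewrite -natrM.
Qed.

Lemma conc_entE (R : realType) (n : nat) (psi : bits n -> R[i])
    (phi : 'I_4 -> bool -> R[i]) (S : {set 'I_n}) :
  is_pure_state psi -> is_SIC phi ->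
  conc_ent psi S = 1 - 3 ^+ #|S| * \sum_(q : outcome S) sic_prob psi phi q ^+ 2.
Proof. by move=> psi1 sic; rewrite sic_collision. Qed.

(** The left side is the mean of the 2^s purities of subsets of [S], each at most 1. It controls the
    variance of a batch. *)
Lemma sic_collision_le1 (R : realType) (n : nat) (psi : bits n -> R[i])
    (phi : 'I_4 -> bool -> R[i]) (S : {set 'I_n}) :
  is_pure_state psi -> is_SIC phi ->
  3 ^+ #|S| * \sum_(q : outcome S) sic_prob psi phi q ^+ 2 <= 1.
Proof.
move=> psi1 sic; rewrite sic_collision // ler_pdivrMl ?exprn_gt0 // mulr1.
apply: le_trans (ler_sum _ (fun A _ => purity_le1 _ _ psi A psi1)) _.
rewrite sumr_const -natrX -card_powerset.
by rewrite (eq_card (B := powerset S)) // => A; rewrite powersetE.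
Qed.

(** * Batch estimators *)

(** A pair of samples is a function on [bool]. The collision event splits by the common value [t],
    and independence gives [P t ^+ 2]. *)
Lemma pair_collision (R : comNzRingType) (T : finType) (P : T -> R) :
  \sum_(w : {ffun bool -> T}) (\prod_c P (w c)) * (w false == w true)%:R
  = \sum_t P t ^+ 2.
Proof.
transitivity (\sum_t \prod_(c : bool) \sum_t' P t' * (t' == t)%:R); last first.
  apply: eq_bigr => t _; rewrite prodr_const card_bool; congr (_ ^+ 2).
  by rewrite -[RHS](sum_indic _ _ t); apply: eq_bigr => t' _; rewrite mulrC.
under [RHS]eq_bigr => t _ do rewrite -(iid_prod _ _ _ P (fun=> fun t' => (t' == t)%:R)).
rewrite exchange_big; apply: eq_bigr => w _ /=; rewrite -mulr_sumr; congr (_ * _).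
rewrite -(sum_indic _ _ (w true) (fun t => (w false == t)%:R)).
by apply: eq_bigr => t _; rewrite big_bool eq_sym.
Qed.

(** Here [L] stands for 3^s and [p] is the collision probability. The variance of a batch is L^2 (p
    - p^2) / B <= L / B <= eps^2 / 4, by [L * p <= 1]. *)
Lemma batch_deviation (R : realType) (T : finType) (P : T -> R) (B : nat)
    (L p eps : R) :
  (forall t, 0 <= P t) -> \sum_t P t = 1 -> p = \sum_t P t ^+ 2 ->
  0 < L -> L * p <= 1 -> 0 < eps -> 4 * L / eps ^+ 2 <= B%:R ->
  \sum_(u : {ffun 'I_B * bool -> T}) (\prod_k P (u k))
    * (eps <= `|1 - L * B%:R^-1 * \sum_(i < B) (u (i, false) == u (i, true))%:R
               - (1 - L * p)|)%R%:R
  <= 4^-1.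
Proof.
move=> P0 P1 pE L0 Lp eps0 Bge.
have B0 : 0 < B%:R :> R.
  by apply: lt_le_trans Bge; rewrite divr_gt0 ?exprn_gt0 // mulr_gt0.
pose F (v : {ffun 'I_B -> {ffun bool -> T}}) : R :=
  (eps <= `|1 - L * B%:R^-1 * \sum_(i < B) (v i false == v i true)%:R
               - (1 - L * p)|)%R%:R.
pose mu (w : {ffun bool -> T}) := \prod_c P (w c).
pose Y (w : {ffun bool -> T}) : R := (w false == w true)%:R - p.
have mu0 w : 0 <= mu w by exact: prodr_ge0.
have mu1 : \sum_w mu w = 1.
  by rewrite -(bigA_distr_bigA (fun=> P)) big1.
have muX : \sum_w mu w * (w false == w true)%:R = p by rewrite pE -pair_collision.
have Y0 : \sum_w mu w * Y w = 0.
  under eq_bigr => w _ do rewrite mulrBr.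
  by rewrite sumrB muX -mulr_suml mu1 mul1r subrr.
have Y2 : \sum_w mu w * Y w ^+ 2 = p - p ^+ 2.
  (* An indicator X is its own square, hence (X - p)^2 = (1 - 2p) X + p^2. *)
  rewrite (eq_bigr (fun w => (1 - 2 * p) * (mu w * (w false == w true)%:R)
                              + p ^+ 2 * mu w)).
    by rewrite big_split -!mulr_sumr muX mu1 /=; ring.
  by move=> w _; rewrite /Y; case: (_ == _); rewrite /=; ring.
have p0 : 0 <= p by rewrite pE; apply: sumr_ge0 => t _; exact: sqr_ge0.
have idb : bijective (@id ('I_B * bool)) by exists id.
rewrite (eq_bigr (fun u : {ffun 'I_B * bool -> T} =>
  (\prod_k P (u k)) * F [ffun a => [ffun k => u (id (a, k))]])); last first.
  move=> u _; congr (_ * _); rewrite /F.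
  congr ((nat_of_bool (_ <= `|_ - _ * _ - _|))%:R).
  by apply: eq_bigr => i _; rewrite !ffunE.
rewrite (iid_curry _ _ _ _ _ _ P F idb).
(* The estimator is affine in the collision count with slope -L/B, so an error [eps] is a deviation
   B eps / L of the centred count. *)
have e0 : 0 < B%:R * eps / L by rewrite divr_gt0 // mulr_gt0.
apply: le_trans (_ : _ <= #|'I_B|%:R * (p - p ^+ 2) / (B%:R * eps / L) ^+ 2) _.
  rewrite -Y2; apply: le_trans (iid_chebyshev _ _ _ mu Y _ mu0 mu1 Y0 e0).
  apply: ler_sum => v _; apply: ler_wpM2l.
    by apply: prodr_ge0 => i _; exact: mu0.
  rewrite /F; apply: ler_indic.
  have -> : \sum_(i < B) (v i false == v i true)%:R = \sum_i Y (v i) + B%:R * p.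
    by rewrite sumrB sumr_const card_ord -[p *+ B]mulr_natl subrK.
  have -> : 1 - L / B%:R * (\sum_i Y (v i) + B%:R * p) - (1 - L * p)
      = - (L / B%:R * \sum_i Y (v i)) by field; rewrite gt_eqF.
  rewrite normrN normrM gtr0_norm ?divr_gt0 //.
  by rewrite ler_pdivrMr // mulrAC ler_pdivlMr // mulrC [_ * L]mulrC.
rewrite card_ord ler_pdivrMr ?exprn_gt0 //.
have eps2 : 0 < eps ^+ 2 by rewrite exprn_gt0.
have H : 4 * L <= B%:R * eps ^+ 2 by rewrite -ler_pdivrMr.
have -> : 4^-1 * (B%:R * eps / L) ^+ 2 = B%:R * ((B%:R * eps ^+ 2) / (4 * L ^+ 2)).
  by field; rewrite gt_eqF.
apply: ler_wpM2l; first exact: ltW.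
rewrite ler_pdivlMr ?mulr_gt0 ?exprn_gt0 //.
apply: le_trans H.
have -> : (p - p ^+ 2) * (4 * L ^+ 2) = 4 * L * (L * p * (1 - p)) by ring.
apply: ler_piMr; first by rewrite mulr_ge0 // ltW.
nra.
Qed.

(** * Indexing of the samples by batch, pair and position in the pair *)

Lemma sample_index_subproof (N B : nat) (x : 'I_N * ('I_B * bool)) :
  (2 * (x.1 * B + x.2.1) + x.2.2 < 2 * N * B)%N.
Proof. by case: x => [[b bN] [[i iB] c]] /=; case: c => /=; nia. Qed.

Definition sample_index (N B : nat) (x : 'I_N * ('I_B * bool)) : 'I_(2 * N * B) :=
  Ordinal (sample_index_subproof N B x).

(** Parity recovers the position in the pair, and division by [B] then separates batch from pair;
    equal cardinalities give surjectivity. *)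
Lemma sample_index_bij (N B : nat) : bijective (sample_index N B).
Proof.
apply: inj_card_bij; last by rewrite !card_prod !card_ord card_bool; lia.
case=> [b [i c]] [b' [i' c']] /(congr1 val) /= H.
have c_eq : c = c' by case: c c' H => [] []; lia.
have H2 : (b * B + i = b' * B + i')%N by move: H; rewrite c_eq; lia.
have bb : b = b'.
  apply: val_inj; have := congr1 (fun k => k %/ B)%N H2.
  have B0 : (0 < B)%N by apply: leq_ltn_trans (ltn_ord i).
  by rewrite /= !divnMDl // !divn_small // !addn0.
have ii : i = i' by apply: val_inj => /=; move: H2; rewrite bb; lia.
by rewrite bb ii c_eq.
Qed.

Lemma at_ord (T : Type) (M : nat) (Q : {ffun 'I_M -> T}) (x0 : T) (i : 'I_M) :
  at_ Q x0 i = Q i.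
Proof. by rewrite /at_ valK. Qed.

Lemma batch_estE (R : realType) (n : nat) (S : {set 'I_n}) (N B : nat)
    (Q : {ffun 'I_(2 * N * B) -> outcome S}) (b : 'I_N) :
  batch_est R B Q b.+1
  = 1 - 3 ^+ #|S| * B%:R^-1 * \sum_(i < B)
      (Q (sample_index N B (b, (i, false))) == Q (sample_index N B (b, (i, true))))%:R.
Proof.
rewrite /batch_est; congr (_ - _ * _).
rewrite -[X in \sum_(X <= _ < _) _]add0n big_addn.
have -> : (b.+1 * B + 1 - ((b.+1 - 1) * B + 1) = B)%N by nia.
rewrite big_mkord; apply: eq_bigr => i _.
(* The 1-based pair number is k = bB + i + 1, and Q_(2k-1), Q_(2k) sit at positions 2k - 2 and 2k -
   1; both are in range, so the default of [at_] is never read. *)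
have -> : (2 * (i + ((b.+1 - 1) * B + 1)) - 1 - 1
           = sample_index N B (b, (i, false)))%N by rewrite /= subn1 /=; nia.
have -> : (2 * (i + ((b.+1 - 1) * B + 1)) - 1
           = sample_index N B (b, (i, true)))%N by rewrite /= subn1 /=; nia.
by rewrite !at_ord.
Qed.

Lemma count_iota_ord (N : nat) (a : pred nat) :
  count a (iota 1 N) = #|[set b : 'I_N | a b.+1]|.
Proof.
rewrite -[1%N]addn0 iotaDl -val_enum_ord -map_comp count_map cardE -size_filter.
by rewrite enumT; congr size; apply: eq_filter => b /=; rewrite inE.
Qed.

Theorem theorem4 (R : realType) (n : nat) (psi : bits n -> R[i])
    (phi : 'I_4 -> bool -> R[i]) (S : {set 'I_n}) (eps delta : R) :
  is_pure_state psi -> is_SIC phi -> S != set0 ->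
  0 < eps -> 0 < delta < 1 ->
  let NB := NB delta in
  let B := Bsz #|S| eps in
  let M := (2 * NB * B)%N in
  (* probability over M i.i.d. outcomes Q_1..Q_M with law sic_prob *)
  \sum_(Q : {ffun 'I_M -> outcome S})
     (\prod_(k : 'I_M) sic_prob psi phi (Q k))
     * ((eps <= `| median [seq @batch_est R n S B M Q b | b <- iota 1 NB]
                  - conc_ent psi S |)%R)%:R
  <= delta.
Proof.
move=> psi1 sic _ eps0 /andP[delta0 delta1]; cbv zeta.
set N := NB delta; set B := Bsz _ _.
set P := @sic_prob R n psi phi S.
have P0 q : 0 <= P q by exact: sic_prob_ge0.
have P1 : \sum_q P q = 1 by exact: sum_sic_prob.
(* The absolute value in [NB] and [Bsz] is harmless, the ceiling of a nonnegative real being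
   nonnegative. *)
have nat_ceil (x : R) : 0 <= x -> x <= `|Num.ceil x|%N%:R.
  move=> x0; rewrite natr_absz ger0_norm ?ceil_ge //.
  by rewrite ceil_ge0; lra.
have Bge : 4 * 3 ^+ #|S| / eps ^+ 2 <= B%:R.
  by apply: nat_ceil; rewrite divr_ge0 ?mulr_ge0 ?exprn_ge0 ?ltW.
have Nge : 8 * ln (delta^-1) <= N%:R.
  by apply: nat_ceil; rewrite mulr_ge0 // ln_ge0 // invf_ge1 // ltW.
pose bad (u : {ffun 'I_B * bool -> outcome S}) :=
  eps <= `|1 - 3 ^+ #|S| * B%:R^-1
               * \sum_(i < B) (u (i, false) == u (i, true))%:R - conc_ent psi S|.
pose F (q : {ffun 'I_N -> {ffun 'I_B * bool -> outcome S}}) : R :=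
  (N <= 2 * #|[set b | bad (q b)]|)%N%:R.
(* A median off by [eps] forces at least half of the batches to be bad, an event expressed through
   the separate batches. *)
apply: le_trans (_ : _ <= \sum_(Q : {ffun 'I_(2 * N * B) -> outcome S})
    (\prod_k P (Q k)) * F [ffun b => [ffun k => Q (sample_index N B (b, k))]]) _.
  apply: ler_sum => Q _; rewrite ler_wpM2l ?prodr_ge0 //.
  apply: ler_indic => /median_majority.
  rewrite size_map size_iota count_map count_iota_ord /=.
  congr (_ <= 2 * _)%N; apply: eq_card => b; rewrite !inE batch_estE /bad.
  congr (_ <= `|_ - _ * _ - _|); apply: eq_bigr => i _; by rewrite !ffunE.
rewrite (iid_curry _ _ _ _ _ _ P F (sample_index_bij N B)).
(* Each batch is bad with probability at most 1/4, so the majority bound applies; [Nge] then brings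
   it below [delta]. *)
apply: le_trans (_ : expR (- (N%:R / 8)) <= _).
  rewrite /F; apply: (iid_majority _ _ N
    (fun u : {ffun 'I_B * bool -> outcome S} => \prod_k P (u k)) bad).
  - by move=> u; exact: prodr_ge0.
  - by rewrite -(bigA_distr_bigA (fun=> P)) big1.
  - rewrite /bad (conc_entE _ _ _ phi) //.
    apply: batch_deviation => //; first by rewrite exprn_gt0.
    exact: sic_collision_le1.
rewrite -[leRHS]lnK ?posrE // ler_expR.
by move: Nge; rewrite lnV ?posrE //; lra.
Qed.
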